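(* Let $(\mathcal X,\mathcal Y)$ be an admissible balanced pair in an abelian category $\mathcal A$ and let $(\mathcal C,\mathcal D)$ be a hereditary cotorsion pair relative to $(\mathcal X,\mathcal Y)$. Then the following statements are equivalent. (1) $(\mathcal C,\mathcal D)$ is perfect. (2) Every object of $\mathcal A$ has a minimal right $\mathcal C$-approximation and every object of $\mathcal C$ has a minimal left $\mathcal D$-approximation. (3) Every object of $\mathcal A$ has a minimal left $\mathcal D$-approximation and every object of $\mathcal D$ has a minimal right $\mathcal C$-approximation.
   Context: $\mathcal A$ is an abelian category; a subcategory of $\mathcal A$ means a full additive subcategory closed under isomorphisms and direct summands. A morphism $f:X\to M$ with $X\in\mathcal X$ is a right $\mathcal X$-approximation of $M$ if every morphism $X'\to M$ with $X'\in\mathcal X$ factors through $f$; it is minimal (right minimal) if every endomorphism $s:X\to X$ with $f=fs$ is an automorphism. $\mathcal X$ is contravariantly finite in $\mathcal A$ if every object of $\mathcal A$ has a right $\mathcal X$-approximation. (Minimal) left approximations and covariantly finite subcategories are defined dually. A complex $A^\bullet$ in $\mathcal A$ is right $\mathcal X$-acyclic if $\operatorname{Hom}_{\mathcal A}(X,A^\bullet)$ is acyclic for all $X\in\mathcal X$, and left $\mathcal X$-acyclic if $\operatorname{Hom}_{\mathcal A}(A^\bullet,X)$ is acyclic for all $X\in\mathcal X$. For $\mathcal X$ contravariantly finite, an $\mathcal X$-resolution of $M$ is a right $\mathcal X$-acyclic complex $\cdots\to X^{-1}\to X^0\to M\to 0$ with all $X^i\in\mathcal X$; the complex $X^\bullet=(\cdots\to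 X^{-1}\to X^0\to 0)$ is the deleted resolution. For $\mathcal Y$ covariantly finite, a $\mathcal Y$-coresolution of $N$ is a left $\mathcal Y$-acyclic complex $0\to N\to Y^0\to Y^1\to\cdots$ with all $Y^i\in\mathcal Y$. A pair $(\mathcal X,\mathcal Y)$ of subcategories is a balanced pair if $\mathcal X$ is contravariantly finite, $\mathcal Y$ is covariantly finite, every $M\in\mathcal A$ has an $\mathcal X$-resolution that is left $\mathcal Y$-acyclic, and every $N\in\mathcal A$ has a $\mathcal Y$-coresolution that is right $\mathcal X$-acyclic. In that case a complex is right $\mathcal X$-acyclic if and only if it is left $\mathcal Y$-acyclic; such complexes are called $\ast$-acyclic. The balanced pair is admissible if every right $\mathcal X$-approximation is an epimorphism (equivalently, every left $\mathcal Y$-approximation is a monomorphism). For $M,N\in\mathcal A$ put $\operatorname{Ext}_\ast^i(M,N):=H^i(\operatorname{Hom}_{\mathcal A}(X^\bullet,N))\cong H^i(\operatorname{Hom}_{\mathcal A}(M,Y^\bullet))$, where $X^\bullet\to M$ is an $\mathcal X$-resolution and $N\to Y^\bullet$ a $\mathcal Y$-coresolution (independent of choices). A pair $(\mathcal C,\mathcal D)$ of subcategories is a cotorsion pair relative to $(\mathcal X,\mathcal Y)$ if $\mathcal C=\{C\in\mathcal A\mid \operatorname{Ext}^1_\ast(C,D)=0\ \forall D\in\mathcal D\}$ and $\mathcal D=\{D\in\mathcal A\mid \operatorname{Ext}^1_\ast(C,D)=0\ \forall C\in\mathcal C\}$. It is hereditary if it satisfies the following mutually equivalent conditions: (i) $\operatorname{Ext}_\ast^i(C,D)=0$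 for all $i\ge1$, $C\in\mathcal C$, $D\in\mathcal D$; (ii) $\mathcal X\subseteq\mathcal C$ and for every $\ast$-acyclic complex $0\to L\to M\to N\to 0$ with $N\in\mathcal C$ one has: $L\in\mathcal C$ implies $M\in\mathcal C$, and $M\in\mathcal C$ implies $L\in\mathcal C$; (iii) $\mathcal Y\subseteq\mathcal D$ and for every $\ast$-acyclic complex $0\to L\to M\to N\to 0$ with $L\in\mathcal D$ one has: $N\in\mathcal D$ implies $M\in\mathcal D$, and $M\in\mathcal D$ implies $N\in\mathcal D$. It is perfect if every object of $\mathcal A$ has a minimal right $\mathcal C$-approximation and a minimal left $\mathcal D$-approximation. *)

(* Defs.v *)
From HB Require Import structures.
From mathcomp Require Import all_boot all_order all_algebra.
From mathcomp Require Import generic_quotient ring_quotient boolp.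
Set Implicit Arguments.
Unset Strict Implicit.
Unset Printing Implicit Defensive.
Import GRing.Theory.
Local Open Scope ring_scope.

Record preadditiveCat := PreadditiveCat {
  ob :> Type;
  hom : ob -> ob -> zmodType;
  idm : forall A, hom A A;
  comp : forall A B C, hom B C -> hom A B -> hom A C;
  compA : forall A B C D (h : hom C D) (g : hom B C) (f : hom A B),
    comp h (comp g f) = comp (comp h g) f;
  comp1m : forall A B (f : hom A B), comp (idm B) f = f;
  compm1 : forall A B (f : hom A B), comp f (idm A) = f;
  compDl : forall A B C (g g' : hom B C) (f : hom A B),
    comp (g + g') f = comp g f + comp g' f;
  compDr : forall A B C (g : hom B C) (f f' : hom A B),
    comp g (f + f') = comp g f + comp g f' }.

Arguments hom {p}.
Arguments idm {p}.
Arguments comp {p A B C}.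

Declare Scope cat_scope.
Delimit Scope cat_scope with cat.
Notation "g ∘ f" := (comp g f) (at level 40, left associativity) : cat_scope.
Local Open Scope cat_scope.

Section Morphisms.
Variable A : preadditiveCat.
Implicit Types M N K : A.

Definition is_iso M N (f : hom M N) : Prop :=
  exists g : hom N M, g ∘ f = idm M /\ f ∘ g = idm N.

Definition isomorphic M N : Prop := exists f : hom M N, is_iso f.

Definition mono M N (f : hom M N) : Prop :=
  forall K (g h : hom K M), f ∘ g = f ∘ h -> g = h.

Definition epi M N (f : hom M N) : Prop :=
  forall K (g h : hom N K), g ∘ f = h ∘ f -> g = h.

Definition is_kernel K M N (k : hom K M) (f : hom M N) : Prop :=
  f ∘ k = 0 /\
  forall L (g : hom L M), f ∘ g = 0 -> exists! u : hom L K, k ∘ u = g.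

Definition is_cokernel M N K (c : hom N K) (f : hom M N) : Prop :=
  c ∘ f = 0 /\
  forall L (g : hom N L), g ∘ f = 0 -> exists! u : hom K L, u ∘ c = g.

Definition is_zero_object Z : Prop :=
  forall M, (forall f : hom M Z, f = 0) /\ (forall f : hom Z M, f = 0).

Definition is_biproduct M N S : Prop :=
  exists (i : hom M S) (j : hom N S) (p : hom S M) (q : hom S N),
    [/\ p ∘ i = idm M, q ∘ j = idm N, q ∘ i = 0, p ∘ j = 0
      & i ∘ p + j ∘ q = idm S].

End Morphisms.

Record abelianCat := AbelianCat {
  abelian_base :> preadditiveCat;
  zob : abelian_base;
  zobP : is_zero_object zob;
  has_biproduct : forall M N : abelian_base, exists S, is_biproduct M N S;
  has_kernel : forall (M N : abelian_base) (f : hom M N),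
    exists K (k : hom K M), is_kernel k f;
  has_cokernel : forall (M N : abelian_base) (f : hom M N),
    exists K (c : hom N K), is_cokernel c f;
  mono_is_kernel : forall (M N : abelian_base) (f : hom M N),
    mono f -> exists K (g : hom N K), is_kernel f g;
  epi_is_cokernel : forall (M N : abelian_base) (f : hom M N),
    epi f -> exists K (g : hom K M), is_cokernel f g }.

Arguments zob {a}.

Lemma comp0m (A : preadditiveCat) (M N L : A) (f : hom M N) :
  (0 : hom N L) ∘ f = 0.
Proof. by apply: (addIr (0 ∘ f)); rewrite -compDl !add0r. Qed.

Lemma compm0 (A : preadditiveCat) (M N L : A) (g : hom N L) :
  g ∘ (0 : hom M N) = 0.
Proof. by apply: (addIr (g ∘ 0)); rewrite -compDr !add0r. Qed.

Lemma compNl (A : preadditiveCat) (M N L : A) (g : hom N L) (f : hom M N) :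
  (- g) ∘ f = - (g ∘ f).
Proof. by apply/eqP; rewrite -addr_eq0 -compDl addNr comp0m. Qed.

Lemma compBl (A : preadditiveCat) (M N L : A) (g h : hom N L) (f : hom M N) :
  (g - h) ∘ f = g ∘ f - h ∘ f.
Proof. by rewrite compDl compNl. Qed.

Section Approximations.
Variable A : abelianCat.
Implicit Types (P : A -> Prop) (M N : A).

(* A full subcategory is given by its class of objects. *)
Record subcategory P : Prop := Subcategory {
  subcat_zero : P zob;
  subcat_biproduct : forall M N S, is_biproduct M N S -> P M -> P N -> P S;
  subcat_iso : forall M N, isomorphic M N -> P M -> P N;
  subcat_summand : forall M N S, is_biproduct M N S -> P S -> P M }.

Definition right_approximation P X M (f : hom X M) : Prop :=
  P X /\ forall X' (g : hom X' M), P X' -> exists h : hom X' X, f ∘ h = g.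

Definition left_approximation P M Y (f : hom M Y) : Prop :=
  P Y /\ forall Y' (g : hom M Y'), P Y' -> exists h : hom Y Y', h ∘ f = g.

Definition right_minimal M N (f : hom M N) : Prop :=
  forall s : hom M M, f = f ∘ s -> is_iso s.

Definition left_minimal M N (f : hom M N) : Prop :=
  forall s : hom N N, f = s ∘ f -> is_iso s.

Definition contravariantly_finite P : Prop :=
  forall M, exists X (f : hom X M), right_approximation P f.

Definition covariantly_finite P : Prop :=
  forall M, exists Y (f : hom M Y), left_approximation P f.

Definition has_minimal_right_approximation P M : Prop :=
  exists X (f : hom X M), right_approximation P f /\ right_minimal f.

Definition has_minimal_left_approximation P M : Prop :=
  exists Y (f : hom M Y), left_approximation P f /\ left_minimal f.

End Approximations.

(* The successor on int.  Unlike [i + 1], it reduces on [Negz n.+1], so that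
   complexes can be defined by cases on the degree without any cast. *)
Definition succz (i : int) : int :=
  match i with
  | Posz n => Posz n.+1
  | Negz 0 => Posz 0
  | Negz n.+1 => Negz n
  end.

Record complex (A : abelianCat) := Complex {
  cpx :> int -> A;
  diff : forall i, hom (cpx i) (cpx (succz i));
  diff_diff : forall i, diff (succz i) ∘ diff i = 0 }.

Definition exact_at (U V W : zmodType) (f : U -> V) (g : V -> W) : Prop :=
  forall v : V, g v = 0 <-> exists u : U, f u = v.

Section Acyclicity.
Variable A : abelianCat.
Implicit Types (P : A -> Prop) (K : complex A).

Definition right_acyclic P K : Prop :=
  forall X, P X -> forall i,
    exact_at (fun h : hom X (K i) => diff K i ∘ h)
             (fun h : hom X (K (succz i)) => diff K (succz i) ∘ h).

Definition left_acyclic P K : Prop :=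
  forall Y, P Y -> forall i,
    exact_at (fun h : hom (K (succz (succz i))) Y => h ∘ diff K (succz i))
             (fun h : hom (K (succz i)) Y => h ∘ diff K i).

End Acyclicity.

Section Resolutions.
Variable A : abelianCat.
Implicit Types P : A -> Prop.

(* [aug_ob n] is the term X^{-n}. *)
Record augmented (M : A) := Augmented {
  aug_ob : nat -> A;
  aug_d : forall n, hom (aug_ob n.+1) (aug_ob n);
  aug_e : hom (aug_ob 0) M;
  aug_dd : forall n, aug_d n ∘ aug_d n.+1 = 0;
  aug_ed : aug_e ∘ aug_d 0 = 0 }.

Section AugmentedComplex.
Variables (M : A) (R : augmented M).

Definition augmented_cpx (i : int) : A :=
  match i with
  | Negz n => aug_ob R n
  | Posz 0 => M
  | Posz _.+1 => zob
  end.

Definition augmented_diff (i : int) :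
    hom (augmented_cpx i) (augmented_cpx (succz i)) :=
  match i with
  | Negz n.+1 => aug_d R n
  | Negz 0 => aug_e R
  | Posz _ => 0
  end.

Fact augmented_diff_diff i : augmented_diff (succz i) ∘ augmented_diff i = 0.
Proof.
case: i => [n|[|[|n]]] /=; [exact: comp0m | exact: comp0m | exact: aug_ed |].
exact: aug_dd.
Qed.

(* ... -> X^{-1} -> X^0 -> M -> 0 -> ..., with M in degree 0 *)
Definition augmented_complex : complex A := Complex augmented_diff_diff.

End AugmentedComplex.

Record coaugmented (N : A) := Coaugmented {
  coaug_ob : nat -> A;
  coaug_d : forall n, hom (coaug_ob n) (coaug_ob n.+1);
  coaug_e : hom N (coaug_ob 0);
  coaug_dd : forall n, coaug_d n.+1 ∘ coaug_d n = 0;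
  coaug_de : coaug_d 0 ∘ coaug_e = 0 }.

Section CoaugmentedComplex.
Variables (N : A) (R : coaugmented N).

Definition coaugmented_cpx (i : int) : A :=
  match i with
  | Posz n => coaug_ob R n
  | Negz 0 => N
  | Negz _.+1 => zob
  end.

Definition coaugmented_diff (i : int) :
    hom (coaugmented_cpx i) (coaugmented_cpx (succz i)) :=
  match i with
  | Posz n => coaug_d R n
  | Negz 0 => coaug_e R
  | Negz _.+1 => 0
  end.

Fact coaugmented_diff_diff i :
  coaugmented_diff (succz i) ∘ coaugmented_diff i = 0.
Proof.
case: i => [n|[|n]] /=; [exact: coaug_dd | exact: coaug_de | exact: compm0].
Qed.

(* ... -> 0 -> N -> Y^0 -> Y^1 -> ..., with N in degree -1 *)
Definition coaugmented_complex : complex A := Complex coaugmented_diff_diff.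

End CoaugmentedComplex.

Definition is_resolution P M (R : augmented M) : Prop :=
  (forall n, P (aug_ob R n)) /\ right_acyclic P (augmented_complex R).

Definition is_coresolution P N (R : coaugmented N) : Prop :=
  (forall n, P (coaug_ob R n)) /\ left_acyclic P (coaugmented_complex R).

End Resolutions.

Section Cocycles.
Variables (A : abelianCat) (M : A) (R : augmented M) (N : A) (i : nat).

Definition cocycles : {pred hom (aug_ob R i) N} :=
  fun f => f ∘ aug_d R i == 0.

Fact cocycles_zmod_closed : zmod_closed cocycles.
Proof.
split=> [|f g]; rewrite !unfold_in ?comp0m // => /eqP f0 /eqP g0.
by rewrite compBl f0 g0 subr0.
Qed.

HB.instance Definition _ :=
  GRing.isZmodClosed.Build _ cocycles cocycles_zmod_closed.

Record cocycle := Cocycle { cocycle_val : hom (aug_ob R i) N;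
                            _ : cocycle_val \in cocycles }.

HB.instance Definition _ := [isSub for cocycle_val].
HB.instance Definition _ := [Choice of cocycle by <:].
HB.instance Definition _ := [SubChoice_isSubZmodule of cocycle by <:].

End Cocycles.

Arguments cocycles {A M} R N i.

Definition is_coboundary (A : abelianCat) (M : A) (R : augmented M) (N : A)
    (i : nat) : hom (aug_ob R i) N -> Prop :=
  match i return hom (aug_ob R i) N -> Prop with
  | 0 => fun f => f = 0
  | k.+1 => fun f => exists h : hom (aug_ob R k) N, f = h ∘ aug_d R k
  end.

Fact is_coboundary0 (A : abelianCat) (M : A) (R : augmented M) (N : A)
    (i : nat) : is_coboundary (0 : hom (aug_ob R i) N).
Proof. by case: i => [|k] //=; exists 0; rewrite comp0m. Qed.

Fact is_coboundaryB (A : abelianCat) (M : A) (R : augmented M) (N : A)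
    (i : nat) (f g : hom (aug_ob R i) N) :
  is_coboundary f -> is_coboundary g -> is_coboundary (f - g).
Proof.
case: i f g => [|k] f g /=; first by move=> -> ->; rewrite subr0.
by case=> [a ->] [b ->]; exists (a - b); rewrite compBl.
Qed.

Section CohomologyGroup.
Variables (A : abelianCat) (M : A) (R : augmented M) (N : A) (i : nat).

Definition coboundaries : {pred cocycle R N i} :=
  fun f => `[< is_coboundary (val f) >].

Fact coboundaries_zmod_closed : zmod_closed coboundaries.
Proof.
split=> [|f g]; rewrite !unfold_in.
  by apply/asboolP; rewrite raddf0; apply: is_coboundary0.
move=> /asboolP Hf /asboolP Hg; apply/asboolP; rewrite raddfB.
exact: is_coboundaryB.
Qed.

HB.instance Definition _ :=
  GRing.isZmodClosed.Build _ coboundaries coboundaries_zmod_closed.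

Definition cohomology : zmodType := Quotient.quot coboundaries.

End CohomologyGroup.

Arguments coboundaries {A M} R N i.

Record balanced_pair (A : abelianCat) (X Y : A -> Prop) : Prop := BalancedPair {
  balanced_subl : subcategory X;
  balanced_subr : subcategory Y;
  balanced_contra : contravariantly_finite X;
  balanced_cov : covariantly_finite Y;
  balanced_res : forall M : A, exists R : augmented M,
    is_resolution X R /\ left_acyclic Y (augmented_complex R);
  balanced_cores : forall N : A, exists R : coaugmented N,
    is_coresolution Y R /\ right_acyclic X (coaugmented_complex R) }.

Definition admissible (A : abelianCat) (X : A -> Prop) : Prop :=
  forall (M N : A) (f : hom M N), right_approximation X f -> epi f.

Section RelativeExt.
Variables (A : abelianCat) (X Y : A -> Prop) (bp : balanced_pair X Y).

Fact resolution_exists (M : A) : exists R : augmented M, is_resolution X R.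
Proof. by have [R [HR _]] := balanced_res bp M; exists R. Qed.

(* Up to isomorphism, [Ext] does not depend on the chosen resolution. *)
Definition chosen_resolution (M : A) : augmented M :=
  projT1 (cid (resolution_exists M)).

Definition Ext (i : nat) (M N : A) : zmodType :=
  cohomology (chosen_resolution M) N i.

Definition Ext_vanishes (i : nat) (M N : A) : Prop :=
  forall x : Ext i M N, x = 0.

Record cotorsion_pair (C D : A -> Prop) : Prop := CotorsionPair {
  cotorsion_subl : subcategory C;
  cotorsion_subr : subcategory D;
  cotorsion_leftP : forall M, C M <-> (forall N, D N -> Ext_vanishes 1 M N);
  cotorsion_rightP : forall N, D N <-> (forall M, C M -> Ext_vanishes 1 M N) }.

Definition hereditary (C D : A -> Prop) : Prop :=
  forall i, (1 <= i)%N -> forall M N, C M -> D N -> Ext_vanishes i M N.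

End RelativeExt.

Definition perfect (A : abelianCat) (C D : A -> Prop) : Prop :=
  forall M : A,
    has_minimal_right_approximation C M /\ has_minimal_left_approximation D M.

(* Main.v *)
From mathcomp Require Import all_boot all_algebra.
From mathcomp Require Import generic_quotient ring_quotient boolp.
Require Import Defs.
Set Implicit Arguments.
Unset Strict Implicit.
Unset Printing Implicit Defensive.
Import GRing.Theory.
Local Open Scope ring_scope.
Local Open Scope quotient_scope.
Local Open Scope cat_scope.

(** The conflations, that is, the short exact sequences which stay exact under
    Hom(X, -) and Hom(-, Y), form an exact structure with enough projectives
    in [X] and enough injectives in [Y]. Since the pair is admissible, either
    exactness condition on a short exact sequence implies the other
    ([deflation_conflation], [inflation_conflation]), and vanishing of
    Ext^1(M, N) says that morphisms to N extend along every conflation ending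
    in M, equivalently that morphisms from M lift along every conflation
    starting in N ([orthogonalE], [Ext1_vanishes_orthogonal]). Heredity then
    means that [C] is closed under kernels of deflations and [D] under
    cokernels of inflations. All of this is self-dual, so that one half of the
    theorem, applied in the opposite category, gives the other.

    For that half ([minimal_left_of_minimal_right]), let p : E -> M be a
    minimal right [C]-approximation. It is a deflation, and by Wakamatsu's
    lemma ([wakamatsu]) its kernel K lies in [D]. Let i : E -> F be a minimal
    left [D]-approximation of E; it is an inflation with cokernel N in [C].
    Push out i along p:

      K ---> E --p-> M
      |      |i      |b
      K ---> F --a-> P
             |       |
             N ----> N

    As K and F lie in [D], heredity puts P in [D], and so b, whose cokernel is
    in [C], is a left [D]-approximation of M. It is also minimal: if s b = b,
    then s a lifts along a to some t : F -> F, because F, an extension of N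
    by E, is in [C] and Ext^1(F, K) = 0. The difference t i - i lands in K,
    so it extends to a morphism F -> K; subtracting that from t yields a lift
    t' with t' i = i. By minimality of i, t' is invertible, and hence so is
    the morphism s which it induces on the cokernel P of K -> F. *)

(** * Kernels and cokernels in an abelian category *)

Section Abelian.
Variable A : abelianCat.
Implicit Types K L M N T : A.

Lemma compNr L M N (g : hom M N) (f : hom L M) : g ∘ (- f) = - (g ∘ f).
Proof. by apply/eqP; rewrite -addr_eq0 -compDr addNr compm0. Qed.

Lemma compBr L M N (g : hom M N) (f h : hom L M) :
  g ∘ (f - h) = g ∘ f - g ∘ h.
Proof. by rewrite compDr compNr. Qed.

Lemma mono_eq0 K M N (f : hom M N) (g : hom K M) : mono f -> f ∘ g = 0 -> g = 0.
Proof. by move=> mf fg0; apply: mf; rewrite compm0. Qed.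

Lemma epi_eq0 M N T (f : hom M N) (g : hom N T) : epi f -> g ∘ f = 0 -> g = 0.
Proof. by move=> ef gf0; apply: ef; rewrite comp0m. Qed.

Lemma monoI M N (f : hom M N) :
  (forall K (g : hom K M), f ∘ g = 0 -> g = 0) -> mono f.
Proof.
move=> f0 K g h fgh; apply/eqP; rewrite -subr_eq0; apply/eqP/f0.
by rewrite compBr fgh subrr.
Qed.

Lemma kernel_lift K M N T (k : hom K M) (f : hom M N) (g : hom T M) :
  is_kernel k f -> f ∘ g = 0 -> exists u, k ∘ u = g.
Proof. by case=> _ kP /kP[u [ku _]]; exists u. Qed.

Lemma kernel_mono K M N (k : hom K M) (f : hom M N) : is_kernel k f -> mono k.
Proof.
case=> fk0 kP; apply: monoI => T g kg0.
have [|u [_ uP]] := kP T 0; first by rewrite compm0.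
by rewrite -(uP g kg0) (uP 0) // compm0.
Qed.

Lemma cokernel_factor M N K T (c : hom N K) (f : hom M N) (g : hom N T) :
  is_cokernel c f -> g ∘ f = 0 -> exists u, u ∘ c = g.
Proof. by case=> _ cP /cP[u [uc _]]; exists u. Qed.

Lemma cokernel_epi M N K (c : hom N K) (f : hom M N) : is_cokernel c f -> epi c.
Proof.
case=> cf0 cP T g h ghc.
have [|u [_ uP]] := cP T (g ∘ c); first by rewrite -compA cf0 compm0.
by rewrite -(uP g) // -(uP h).
Qed.

Lemma kernelI K M N (k : hom K M) (f : hom M N) :
  mono k -> f ∘ k = 0 ->
  (forall T (g : hom T M), f ∘ g = 0 -> exists u, k ∘ u = g) -> is_kernel k f.
Proof.
move=> mk fk0 kP; split=> // T g /kP[u ku]; exists u; split=> // v kv.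
by apply: mk; rewrite ku kv.
Qed.

Lemma cokernelI M N K (c : hom N K) (f : hom M N) :
  epi c -> c ∘ f = 0 ->
  (forall T (g : hom N T), g ∘ f = 0 -> exists u, u ∘ c = g) -> is_cokernel c f.
Proof.
move=> ec cf0 cP; split=> // T g /cP[u uc]; exists u; split=> // v vc.
by apply: ec; rewrite uc vc.
Qed.

Lemma epi_cokernel K M N (k : hom K M) (f : hom M N) :
  epi f -> is_kernel k f -> is_cokernel f k.
Proof.
move=> ef [fk0 kP]; apply: cokernelI => // T g gk0.
have [L [h [fh0 hP]]] := epi_is_cokernel ef.
have [u [ku _]] := kP _ h fh0.
have [|v [vf _]] := hP _ g; last by exists v.
by rewrite -ku compA gk0 comp0m.
Qed.

Lemma pushout_exists L M N (f : hom L M) (g : hom L N) :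
  exists (P : A) (a : hom M P) (b : hom N P),
    [/\ a ∘ f = b ∘ g,
        forall T (u : hom M T) (v : hom N T), u ∘ f = v ∘ g ->
          exists w, w ∘ a = u /\ w ∘ b = v
      & forall T (w w' : hom P T), w ∘ a = w' ∘ a -> w ∘ b = w' ∘ b -> w = w'].
Proof.
have [S [i [j [p [q [pi qj qi pj ipjq]]]]]] := has_biproduct M N.
have [P [c cP]] := has_cokernel (i ∘ f - j ∘ g).
exists P, (c ∘ i), (c ∘ j); split.
- by apply/eqP; rewrite -subr_eq0 -!compA -compBr; case: cP => ->.
- move=> T u v ufvg.
  have [|w wc] := @cokernel_factor _ _ _ _ _ _ (u ∘ p + v ∘ q) cP.
    rewrite compBr !compDl -!compA (compA p i) (compA q i) (compA p j).
    rewrite (compA q j) pi qj qi pj !comp0m !comp1m !compm0.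
    by rewrite addr0 add0r ufvg subrr.
  exists w; rewrite !compA wc !compDl -!compA pi qj qi pj.
  by rewrite !compm0 !compm1 addr0 add0r.
- move=> T w w'; rewrite !compA => wi wj; apply: (cokernel_epi cP).
  rewrite -[w ∘ c]compm1 -[w' ∘ c]compm1 -ipjq !compDr !(compA (_ ∘ c)).
  by rewrite wi wj.
Qed.

(** Every morphism from an object of [P] to the target of [g] lifts
    along [g]. *)
Definition lifting (P : A -> Prop) M N (g : hom M N) : Prop :=
  forall T (h : hom T N), P T -> exists u, g ∘ u = h.

(** Every morphism from the source of [f] to an object of [P] extends
    along [f]. *)
Definition extending (P : A -> Prop) M N (f : hom M N) : Prop :=
  forall T (h : hom M T), P T -> exists u, u ∘ f = h.

Lemma lifting_comp (P : A -> Prop) L M N (g : hom M N) (f : hom L M) :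
  lifting P g -> lifting P f -> lifting P (g ∘ f).
Proof.
move=> gP fP T h PT; have [u <-] := gP T h PT; have [v <-] := fP T u PT.
by exists v; rewrite compA.
Qed.

Lemma extending_comp (P : A -> Prop) L M N (g : hom M N) (f : hom L M) :
  extending P g -> extending P f -> extending P (g ∘ f).
Proof.
move=> gP fP T h PT; have [u <-] := fP T h PT; have [v <-] := gP T u PT.
by exists v; rewrite compA.
Qed.

(** A short exact sequence L -> M -> N whose maps are [f] and [g], and which
    stays exact under Hom(T, -) for T in [X] and under Hom(-, T) for
    T in [Y]: a *-acyclic short exact sequence. *)
Definition conflation (X Y : A -> Prop) L M N (f : hom L M) (g : hom M N) :=
  [/\ is_kernel f g, is_cokernel g f, lifting X g & extending Y f].

(** The exact structure given by the conflations has enough projectives in [X]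
    and enough injectives in [Y]; morphisms along which all morphisms from [X]
    lift are epi, and morphisms along which all morphisms to [Y] extend are
    mono. This is the self-dual content of an admissible
    balanced pair. *)
Record relative_exact (X Y : A -> Prop) : Prop := RelativeExact {
  enough_proj : forall M, exists K P (k : hom K P) (p : hom P M),
    X P /\ conflation X Y k p;
  enough_inj : forall N, exists I Z (i : hom N I) (q : hom I Z),
    Y I /\ conflation X Y i q;
  lifting_epi : forall M N (g : hom M N), lifting X g -> epi g;
  extending_mono : forall M N (f : hom M N), extending Y f -> mono f }.

(** Vanishing of the relative Ext^1(M, N), expressed without resolutions:
    for every conflation ending in [M], Hom(-, N) preserves its exactness. *)
Definition orthogonal (X Y : A -> Prop) M N : Prop :=
  forall L E (f : hom L E) (g : hom E M), conflation X Y f g ->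
  forall h : hom L N, exists u : hom E N, u ∘ f = h.

(** The form of [orthogonal] in the opposite category: for every conflation
    starting in [N], Hom(M, -) preserves its exactness. *)
Definition coorthogonal (X Y : A -> Prop) M N : Prop :=
  forall E L (f : hom N E) (g : hom E L), conflation X Y f g ->
  forall h : hom M L, exists u : hom M E, g ∘ u = h.

(** A hereditary cotorsion pair, in self-dual form: heredity is closure of [C]
    under kernels of deflations and of [D] under cokernels of inflations. *)
Record hereditary_cotorsion (X Y C D : A -> Prop) : Prop :=
  HereditaryCotorsion {
  hc_exact : relative_exact X Y;
  hc_left : forall M, C M <-> (forall N, D N -> orthogonal X Y M N);
  hc_right : forall N, D N <-> (forall M, C M -> orthogonal X Y M N);
  hc_kernel : forall L M N (f : hom L M) (g : hom M N),
    conflation X Y f g -> C M -> C N -> C L;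
  hc_cokernel : forall L M N (f : hom L M) (g : hom M N),
    conflation X Y f g -> D L -> D M -> D N }.

End Abelian.

(** * The opposite category *)

(** Hom groups are kept and composition is reversed, so that each notion below
    unfolds in the opposite category to its dual. *)
Definition op_precat (A : preadditiveCat) : preadditiveCat :=
  @PreadditiveCat (ob A) (fun M N => hom N M) (fun M => idm M)
    (fun M N L g f => f ∘ g)
    (fun M N L K h g f => esym (compA f g h))
    (fun M N f => compm1 f) (fun M N f => comp1m f)
    (fun M N L g g' f => compDr f g g') (fun M N L g f f' => compDl f f' g).

Section OppositeAbelian.
Variable A : abelianCat.

Fact op_zobP : is_zero_object (@zob A : op_precat A).
Proof. by move=> M; have [? ?] := @zobP A M; split. Qed.

Fact op_has_biproduct (M N : op_precat A) : exists S, is_biproduct M N S.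
Proof.
have [S [i [j [p [q [pi qj qi pj ipjq]]]]]] := @has_biproduct A M N.
by exists S, p, q, i, j; split.
Qed.

Definition op_cat : abelianCat :=
  @AbelianCat (op_precat A) (@zob A) op_zobP op_has_biproduct
    (fun M N f => @has_cokernel A N M f) (fun M N f => @has_kernel A N M f)
    (fun M N f => @epi_is_cokernel A N M f)
    (fun M N f => @mono_is_kernel A N M f).

End OppositeAbelian.

Lemma conflation_op (A : abelianCat) (X Y : A -> Prop) (L M N : A)
    (f : hom L M) (g : hom M N) :
  @conflation (op_cat A) Y X N M L g f <-> conflation X Y f g.
Proof. by split; case. Qed.

Lemma relative_exact_op (A : abelianCat) (X Y : A -> Prop) :
  relative_exact X Y -> @relative_exact (op_cat A) Y X.
Proof.
case=> proj inj epiX monoY; split=> //.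
- move=> M; have [I [Z [i [q [YI /conflation_op cf]]]]] := inj M.
  by exists Z, I, q, i.
- move=> M; have [K [P [k [p [XP /conflation_op cf]]]]] := proj M.
  by exists P, K, p, k.
- by move=> M N f; apply: (monoY N M f).
- by move=> M N f; apply: (epiX N M f).
Qed.

Lemma orthogonal_op (A : abelianCat) (X Y : A -> Prop) (M N : A) :
  @orthogonal (op_cat A) Y X N M <-> coorthogonal X Y M N.
Proof.
split=> [o E L f g /conflation_op | o L E f g /conflation_op].
  exact: (o L E g f).
exact: (o E L g f).
Qed.

(** * Conflations *)

Section Deflations.
Variables (A : abelianCat) (X Y : A -> Prop).
Implicit Types K L M N T P : A.

(** Schanuel: whether maps to [N] extend along the kernel of an
    [X]-presentation of [M] depends on [M] only. *)
Lemma presentation_extending K P K' P' M N (k : hom K P) (p : hom P M)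
    (k' : hom K' P') (p' : hom P' M) :
  X P -> is_kernel k p -> lifting X p ->
  X P' -> is_kernel k' p' -> lifting X p' ->
  (forall h : hom K N, exists u, u ∘ k = h) ->
  forall h : hom K' N, exists u, u ∘ k' = h.
Proof.
move=> XP kp pX XP' kp' pX' ext h.
have [b p'b] := pX' P p XP; have [a pa] := pX P' p' XP'.
have [|b0 kb0] := @kernel_lift _ _ _ _ _ _ _ (b ∘ k) kp'.
  by rewrite compA p'b; case: kp.
have [|a0 ka0] := @kernel_lift _ _ _ _ _ _ _ (a ∘ k') kp.
  by rewrite compA pa; case: kp'.
have [|w kw] := @kernel_lift _ _ _ _ _ _ _ (b ∘ a - idm P') kp'.
  by rewrite compBr compA p'b pa compm1 subrr.
have [u uk] := ext (h ∘ b0).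
exists (u ∘ a - h ∘ w).
have ba : b0 ∘ a0 = idm K' + w ∘ k'.
  apply: (kernel_mono kp').
  rewrite compDr !compA kb0 kw -compA ka0 compBl compm1 comp1m compA.
  by rewrite [RHS]addrC subrK.
by rewrite compBl -!compA -ka0 compA uk -compA ba compDr compm1 addrK.
Qed.

Hypothesis rel : relative_exact X Y.

(** Hom(X, -)-exactness implies Hom(-, Y)-exactness. With P -> M an
    [X]-presentation of the middle term, P -> N is an [X]-presentation too, and
    morphisms to [Y] extend along its kernel K', because they do so for the
    presentation of N given by [enough_proj]. *)
Lemma deflation_conflation L M N (f : hom L M) (g : hom M N) :
  lifting X g -> is_kernel f g -> conflation X Y f g.
Proof.
move=> gX fg; have gf := epi_cokernel (lifting_epi rel gX) fg.
split=> // T h YT.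
have [K0 [P0 [k0 [p0 [XP0 [kp0 pk0 pX0 kY0]]]]]] := enough_proj rel N.
have [K [P [k [p [XP [kp pk pX kY]]]]]] := enough_proj rel M.
have [K' [k' kp']] := has_kernel (g ∘ p).
have ext : forall h : hom K' T, exists u, u ∘ k' = h.
  apply: (presentation_extending XP0 kp0 pX0 XP kp' (lifting_comp gX pX)).
  by move=> h0; apply: kY0.
have [|r fr] := @kernel_lift _ _ _ _ _ _ _ (p ∘ k') fg.
  by rewrite compA; case: kp'.
(* Being an X-surjection, r is epi: equalities can be checked on K'. *)
have rX : lifting X r.
  move=> Q v XQ; have [w pw] := pX Q (f ∘ v) XQ.
  have [|z kz] := @kernel_lift _ _ _ _ _ _ _ w kp'.
    by rewrite -compA pw compA; case: fg => -> _; rewrite comp0m.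
  exists z; apply: (kernel_mono fg).
  by rewrite compA fr -compA kz pw.
have [v vk'] := ext (h ∘ r).
have [|j kj] := @kernel_lift _ _ _ _ _ _ _ k kp'.
  by rewrite -compA; case: kp => -> _; rewrite compm0.
have rj0 : r ∘ j = 0.
  apply: (mono_eq0 (kernel_mono fg)).
  by rewrite compA fr -compA kj; case: kp.
have [|w wp] := @cokernel_factor _ _ _ _ _ _ _ v pk.
  by rewrite -kj compA vk' -compA rj0 compm0.
exists w; apply: (lifting_epi rel rX).
by rewrite -compA fr compA wp vk'.
Qed.

Lemma lifting_deflation M N (g : hom M N) :
  lifting X g -> exists K (k : hom K M), conflation X Y k g.
Proof.
move=> gX; have [K [k kg]] := has_kernel g.
by exists K, k; apply: deflation_conflation.
Qed.

(** One [X]-presentation of [M] detects the vanishing of Ext^1(M, N): lift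
    P -> M -> L to P -> E, and correct the lift by a morphism P -> N so that
    it vanishes on K. *)
Lemma presentation_coorthogonal K P M N (k : hom K P) (p : hom P M) :
  X P -> conflation X Y k p ->
  (forall h : hom K N, exists u, u ∘ k = h) -> coorthogonal X Y M N.
Proof.
move=> XP [kp pk _ _] ext E L f g [fg gf gX fY] h.
have [a ga] := gX P (h ∘ p) XP.
have [|b fb] := @kernel_lift _ _ _ _ _ _ _ (a ∘ k) fg.
  by rewrite compA ga -compA; case: kp => -> _; rewrite compm0.
have [u uk] := ext b.
have [|v vp] := @cokernel_factor _ _ _ _ _ _ _ (a - f ∘ u) pk.
  by rewrite compBl -fb -compA uk subrr.
exists v; apply: (cokernel_epi pk).
by rewrite -compA vp compBr ga compA; case: fg => -> _; rewrite comp0m subr0.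
Qed.

End Deflations.

Section Conflations.
Variables (A : abelianCat) (X Y : A -> Prop).
Hypothesis rel : relative_exact X Y.
Implicit Types K L M N T P : A.

Lemma inflation_conflation L M N (f : hom L M) (g : hom M N) :
  extending Y f -> is_cokernel g f -> conflation X Y f g.
Proof.
move=> fY gf; apply/conflation_op.
exact: (@deflation_conflation (op_cat A) Y X (relative_exact_op rel) N M L g f).
Qed.

Lemma copresentation_orthogonal I Z M N (i : hom N I) (q : hom I Z) :
  Y I -> conflation X Y i q ->
  (forall h : hom M Z, exists u, q ∘ u = h) -> orthogonal X Y M N.
Proof.
move=> YI /conflation_op cf ext L E f g /conflation_op.
exact: (@presentation_coorthogonal (op_cat A) Y X Z I N M q i YI cf ext
  E L g f).
Qed.

(** The two forms of Ext^1(M, N) = 0 agree, each being computed by a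
    presentation of one of the arguments. *)
Lemma orthogonalE M N : orthogonal X Y M N <-> coorthogonal X Y M N.
Proof.
split=> o.
  have [K [P [k [p [XP kp]]]]] := enough_proj rel M.
  exact: (presentation_coorthogonal XP kp (o _ _ _ _ kp)).
have [I [Z [i [q [YI iq]]]]] := enough_inj rel N.
exact: (copresentation_orthogonal YI iq (o _ _ _ _ iq)).
Qed.

Lemma presentation_orthogonal K P M N (k : hom K P) (p : hom P M) :
  X P -> conflation X Y k p ->
  (forall h : hom K N, exists u, u ∘ k = h) <-> orthogonal X Y M N.
Proof.
move=> XP kp; split=> [ext|o]; last exact: o kp.
exact/orthogonalE/(presentation_coorthogonal XP kp).
Qed.

Lemma orthogonal_X M N : X M -> orthogonal X Y M N.
Proof. by move=> XM; apply/orthogonalE => E L f g [_ _ gX _] h; apply: gX. Qed.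

Lemma orthogonal_Y M N : Y N -> orthogonal X Y M N.
Proof. by move=> YN E L f g [_ _ _ fY] h; apply: fY. Qed.

Lemma orthogonal_extension L M N T (f : hom L M) (g : hom M N) :
  conflation X Y f g -> orthogonal X Y L T -> orthogonal X Y N T ->
  orthogonal X Y M T.
Proof.
move=> [fg gf gX fY] oL /orthogonalE oN.
have [I [Z [i [q [YI iq]]]]] := enough_inj rel T.
apply: (copresentation_orthogonal YI iq) => h.
have [a qa] := (orthogonalE L T).1 oL _ _ _ _ iq (h ∘ f).
have [b bf] := fY I a YI.
have [|c cg] := @cokernel_factor _ _ _ _ _ _ _ (h - q ∘ b) gf.
  by rewrite compBl -compA bf qa subrr.
have [d qd] := oN _ _ _ _ iq c.
by exists (b + d ∘ g); rewrite compDr compA qd cg addrC subrK.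
Qed.

(** Besides its universal property, the pushout of an inflation comes with
    the conflation ending in the same cokernel. *)
Lemma conflation_pushout L M N L' (f : hom L M) (g : hom M N) (h : hom L L') :
  conflation X Y f g ->
  exists (P : A) (a : hom M P) (b : hom L' P) (c : hom P N),
    [/\ a ∘ f = b ∘ h, conflation X Y b c,
        forall T (u : hom M T) (v : hom L' T), u ∘ f = v ∘ h ->
          exists w, w ∘ a = u /\ w ∘ b = v
      & forall T (w w' : hom P T), w ∘ a = w' ∘ a -> w ∘ b = w' ∘ b -> w = w'].
Proof.
move=> [fg gf gX fY]; have [P [a [b [afbh univ joint]]]] := pushout_exists f h.
have [|c [ca cb]] := univ _ g (0 : hom L' N).
  by rewrite comp0m; case: fg.
exists P, a, b, c; split=> //; apply: inflation_conflation.
  move=> T v YT; have [u uf] := fY T (v ∘ h) YT.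
  by have [w [_ wb]] := univ _ u v uf; exists w.
apply: cokernelI => //.
  move=> T u v ucvc; apply: (cokernel_epi gf).
  by rewrite -ca !compA ucvc.
move=> T v vb0; have [|u ug] := @cokernel_factor _ _ _ _ _ _ _ (v ∘ a) gf.
  by rewrite -compA afbh compA vb0 comp0m.
exists u; apply: joint; rewrite -compA ?ca // cb compm0.
by rewrite vb0.
Qed.

End Conflations.

(** * Hereditary cotorsion pairs *)

Lemma hereditary_cotorsion_op (A : abelianCat) (X Y C D : A -> Prop) :
  hereditary_cotorsion X Y C D -> @hereditary_cotorsion (op_cat A) Y X D C.
Proof.
case=> rel CP DP ker coker; split; first exact: relative_exact_op.
- move=> M; split=> [DM N CN | o].
    by apply/orthogonal_op/(orthogonalE rel)/((DP M).1 DM).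
  by apply/DP => N /o/orthogonal_op/(orthogonalE rel).
- move=> M; split=> [CM N DN | o].
    by apply/orthogonal_op/(orthogonalE rel)/((CP M).1 CM).
  by apply/CP => N /o/orthogonal_op/(orthogonalE rel).
- by move=> L M N f g /conflation_op cf DM DN; apply: coker cf DN DM.
- by move=> L M N f g /conflation_op cf CL CM; apply: ker cf CM CL.
Qed.

Section Cotorsion.
Variables (A : abelianCat) (X Y C D : A -> Prop).
Hypothesis hc : hereditary_cotorsion X Y C D.
Let rel := hc_exact hc.
Implicit Types K L M N T P : A.

Lemma hc_orthogonal M N : C M -> D N -> orthogonal X Y M N.
Proof. by move=> CM DN; apply: ((hc_left hc M).1 CM). Qed.

Lemma hc_extension L M N (f : hom L M) (g : hom M N) :
  conflation X Y f g -> C L -> C N -> C M.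
Proof.
move=> fg CL CN; apply/(hc_left hc) => T DT.
by apply: (orthogonal_extension rel fg); apply: hc_orthogonal.
Qed.

(** Wakamatsu's lemma. Let K1 -> P1 -> M' be an [X]-presentation of an object
    M' of [C], and h : K1 -> K. The pushout P of P1 along K1 -> K -> E is in [C],
    and f together with 0 : P1 -> M induces P -> M, which factors through f
    by some r : P -> E. Minimality makes the restriction of r to E invertible;
    composed with its inverse, the restriction of r to P1 takes values in K and
    extends h. *)
Lemma wakamatsu E M (f : hom E M) :
  right_approximation C f -> right_minimal f ->
  exists K (k : hom K E), conflation X Y k f /\ D K.
Proof.
move=> [CE fC] fmin.
have fX : lifting X f.
  move=> T h XT; apply: fC; apply/(hc_left hc) => N _.
  exact: (orthogonal_X rel).
have [K [k kf]] := lifting_deflation rel fX.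
exists K, k; split=> //; apply/(hc_right hc) => M' CM'.
have [K1 [P1 [k1 [p1 [XP1 cf1]]]]] := enough_proj rel M'.
apply/(presentation_orthogonal rel _ XP1 cf1) => h.
have [P [a [b [c [akbk bc univ _]]]]] := conflation_pushout rel (k ∘ h) cf1.
have CP : C P by apply: (hc_extension bc).
have fk0 : f ∘ k = 0 by case: kf => [[]].
have [|w [wa wb]] := univ _ (0 : hom P1 M) f.
  by rewrite comp0m compA fk0 comp0m.
have [r fr] := fC P w CP.
(* s' is the inverse of the endomorphism r b of E. *)
have [|s' [s's ss']] := fmin (r ∘ b); first by rewrite compA fr wb.
have fs' : f ∘ (s' ∘ r ∘ a) = 0.
  have -> : f ∘ (s' ∘ r ∘ a) = f ∘ (r ∘ b ∘ s') ∘ (r ∘ a).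
    by rewrite !compA fr wb.
  by rewrite ss' compm1 compA fr wa.
have [kker _ _ _] := kf; have [u ku] := kernel_lift kker fs'.
exists u; apply: (kernel_mono kker).
by rewrite compA ku -compA akbk compA -(compA s') s's comp1m.
Qed.

End Cotorsion.

Lemma wakamatsu_left (A : abelianCat) (X Y C D : A -> Prop)
    (hc : hereditary_cotorsion X Y C D) (M E : A) (f : hom M E) :
  left_approximation D f -> left_minimal f ->
  exists N (g : hom E N), conflation X Y f g /\ C N.
Proof.
move=> fD fmin.
have fmin' : @right_minimal (op_cat A) _ _ f.
  by move=> s /fmin[t [ts st]]; exists t.
have [N [g [/conflation_op cf CN]]] :=
  @wakamatsu (op_cat A) Y X D C (hereditary_cotorsion_op hc) E M f fD fmin'.
by exists N, g.
Qed.

Lemma minimal_left_of_minimal_right (A : abelianCat) (X Y C D : A -> Prop) :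
  hereditary_cotorsion X Y C D ->
  (forall M : A, has_minimal_right_approximation C M) ->
  (forall M : A, C M -> has_minimal_left_approximation D M) ->
  forall M : A, has_minimal_left_approximation D M.
Proof.
move=> hc minC minD M; have rel := hc_exact hc.
have [E [p [pC pmin]]] := minC M.
have [K [k [kp DK]]] := wakamatsu hc pC pmin.
have CE : C E by case: pC.
have [F [i [iD imin]]] := minD E CE.
have [N [q [iq CN]]] := wakamatsu_left hc iD imin.
have [DF iext] := iD.
have [[_ pk0 pX kY] [_ _ _ iY]] := (kp, iq).
have [P [a [b [c [aibp bc univ joint]]]]] := conflation_pushout rel p iq.
have kia : conflation X Y (i ∘ k) a.
  apply: (inflation_conflation rel); first exact: extending_comp.
  apply: cokernelI.
  - move=> T u v uav; apply: joint => //.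
    apply: (cokernel_epi pk0); rewrite -!compA -aibp !compA.
    by rewrite uav.
  - by rewrite compA aibp -compA; case: pk0 => -> _; rewrite compm0.
  - move=> T u; rewrite compA => uik0.
    have [v vp] := cokernel_factor pk0 uik0.
    by have [w [wa wb]] := univ _ u v (esym vp); exists w.
have DP : D P := hc_cokernel hc kia DK DF.
exists P, b; split.
  by split=> // T h DT; apply: (hc_orthogonal hc CN DT) bc h.
move=> s bsb.
(* F is also in C, so that s a lifts along a. *)
have CF : C F := hc_extension hc iq CE CN.
have [t ats] :=
  (orthogonalE rel F K).1 (hc_orthogonal hc CF DK) _ _ _ _ kia (s ∘ a).
(* t agrees with the identity on E up to a map to K; correct it. *)
have [kiaK aC _ _] := kia.
have [|w kw] := @kernel_lift _ _ _ _ _ _ _ (t ∘ i - i) kiaK.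
  by rewrite compBr compA ats -compA aibp compA -bsb subrr.
have [w' w'i] := iext K w DK.
pose t' := t - i ∘ k ∘ w'.
have at' : a ∘ t' = s ∘ a.
  by rewrite compBr compA; case: kiaK => -> _; rewrite comp0m subr0.
have t'i : t' ∘ i = i by rewrite compBl -compA w'i kw opprB addrC subrK.
have [r [rt tr]] := imin t' (esym t'i).
have ri : r ∘ i = i by rewrite -{1}t'i compA rt comp1m.
have [|s' s'a] := @cokernel_factor _ _ _ _ _ _ _ (a ∘ r) aC.
  by rewrite -compA (compA r) ri; case: kiaK.
have ea := cokernel_epi aC.
exists s'; split; apply: ea; rewrite comp1m -compA.
  by rewrite -at' compA s'a -compA rt compm1.
by rewrite s'a compA -at' -compA tr compm1.
Qed.

Lemma minimal_right_of_minimal_left (A : abelianCat) (X Y C D : A -> Prop) :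
  hereditary_cotorsion X Y C D ->
  (forall M : A, has_minimal_left_approximation D M) ->
  (forall M : A, D M -> has_minimal_right_approximation C M) ->
  forall M : A, has_minimal_right_approximation C M.
Proof.
move=> hc minD minC M.
have [|N DN|E [f [fC fmin]]] :=
  @minimal_left_of_minimal_right (op_cat A) Y X D C
  (hereditary_cotorsion_op hc) _ _ M.
- move=> N; have [E [f [fD fmin]]] := minD N; exists E, f; split=> // s /fmin.
  by case=> t [ts st]; exists t.
- have [E [f [fC fmin]]] := minC N DN; exists E, f; split=> // s /fmin.
  by case=> t [ts st]; exists t.
- by exists E, f; split=> // s /fmin[t [ts st]]; exists t.
Qed.

(** * From resolutions to conflations *)

Section Resolutions.
Variable A : abelianCat.

(** The cycles of a complex exact under Hom(T, -), for T in [P], are covered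
    by its preceding term. *)
Lemma cycle_cover (P : A -> Prop) (U V W : A) (a : hom U V) (b : hom V W) :
  b ∘ a = 0 ->
  (forall T (h : hom T V), P T -> b ∘ h = 0 -> exists u, a ∘ u = h) ->
  exists (Z : A) (k : hom Z V) (p : hom U Z),
    [/\ is_kernel k b, k ∘ p = a & lifting P p].
Proof.
move=> ba0 ab; have [Z [k kb]] := has_kernel b.
have [p kp] := kernel_lift kb ba0.
exists Z, k, p; split=> // T h PT.
have [|u au] := ab T (k ∘ h) PT.
  by rewrite compA; case: kb => -> _; rewrite comp0m.
by exists u; apply: (kernel_mono kb); rewrite compA kp.
Qed.

(** Four terms X2 -> X1 -> X0 -> M of a resolution suffice to make the kernel
    of X0 -> M an inflation. *)
Lemma acyclic_conflation (X Y : A -> Prop) (X2 X1 X0 M : A)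
    (d1 : hom X2 X1) (d0 : hom X1 X0) (e : hom X0 M) :
  (forall (M N : A) (g : hom M N), lifting X g -> epi g) ->
  d0 ∘ d1 = 0 -> e ∘ d0 = 0 -> lifting X e ->
  (forall T (h : hom T X0), X T -> e ∘ h = 0 -> exists u, d0 ∘ u = h) ->
  (forall T (h : hom X1 T), Y T -> h ∘ d1 = 0 -> exists u, u ∘ d0 = h) ->
  exists K (k : hom K X0), conflation X Y k e.
Proof.
move=> epiX dd ed eX ex0 ex1.
have [K [k [p [ke kp pX]]]] := cycle_cover ed ex0.
exists K, k; split=> //; first exact: epi_cokernel (epiX _ _ _ eX) ke.
move=> T h YT; have [|u ud] := ex1 T (h ∘ p) YT.
  rewrite -compA; have -> : p ∘ d1 = 0; last by rewrite compm0.
  by apply: (mono_eq0 (kernel_mono ke)); rewrite compA kp.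
by exists u; apply: (epiX _ _ _ pX); rewrite -compA kp.
Qed.

(** The target of [bd] below. *)
Definition bd_ob (M : A) (R : augmented M) (n : nat) : A :=
  if n is m.+1 then aug_ob R m else M.

(** The map out of the [n]-th term of an augmented complex: the augmentation
    for [n] = 0, a differential otherwise. *)
Definition bd (M : A) (R : augmented M) (n : nat) :
    hom (aug_ob R n) (bd_ob R n) :=
  match n with 0 => aug_e R | m.+1 => aug_d R m end.

Lemma bd_d (M : A) (R : augmented M) n : bd R n ∘ aug_d R n = 0.
Proof. by case: n => [|n]; [apply: aug_ed | apply: aug_dd]. Qed.

Section XResolution.
Variables (X : A -> Prop) (M : A) (R : augmented M).
Hypothesis acR : right_acyclic X (augmented_complex R).

Lemma resolution_lifting : lifting X (aug_e R).
Proof.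
move=> T h XT; have [ex _] := @acR T XT (Negz 0) h.
by apply: ex; apply: comp0m.
Qed.

Lemma resolution_syzygy n : exists (Z : A) (k : hom Z (aug_ob R n)) p,
  [/\ is_kernel k (bd R n), k ∘ p = aug_d R n & lifting X p].
Proof.
apply: cycle_cover; first exact: bd_d.
move=> T h XT bh0; have [ex _] := @acR T XT (Negz n.+1) h.
by apply: ex; case: n h bh0.
Qed.

(** Vanishing of the cohomology of Hom(R, N) in degree [n.+1], read on the
    [n]-th syzygy. *)
Lemma syzygy_extending N n (Z : A) (k : hom Z (aug_ob R n))
    (p : hom (aug_ob R n.+1) Z) :
  (forall (M N : A) (g : hom M N), lifting X g -> epi g) ->
  is_kernel k (bd R n) -> k ∘ p = aug_d R n -> lifting X p ->
  (forall f : hom (aug_ob R n.+1) N, f ∘ aug_d R n.+1 = 0 ->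
     is_coboundary f) <->
  (forall h : hom Z N, exists u, u ∘ k = h).
Proof.
move=> epiX kb kp pX; have mk := kernel_mono kb; split=> [cob h | ext f fd0].
  have [|u hp] := cob (h ∘ p).
    rewrite -compA; have -> : p ∘ aug_d R n.+1 = 0; last by rewrite compm0.
    by apply: (mono_eq0 mk); rewrite compA kp aug_dd.
  by exists u; apply: (epiX _ _ _ pX); rewrite -compA kp.
have [Z' [k' [p' [kb' kp' pX']]]] := resolution_syzygy n.+1.
have pk : is_cokernel p k'.
  apply: (epi_cokernel (epiX _ _ _ pX)); apply: kernelI (kernel_mono kb') _ _.
    by apply: (mono_eq0 mk); rewrite compA kp; case: kb'.
  by move=> T g pg0; apply: (kernel_lift kb'); rewrite /= -kp -compA pg0 compm0.
have [|h hp] := @cokernel_factor _ _ _ _ _ _ _ f pk.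
  by apply: (epiX _ _ _ pX'); rewrite -compA kp' fd0 comp0m.
by have [u uk] := ext h; exists u; rewrite -kp compA uk.
Qed.

End XResolution.

Lemma cohomology_class_eq0 (M : A) (R : augmented M) (N : A) i
    (c : cocycle R N i) :
  \pi_(cohomology R N i) c = 0 <-> is_coboundary (val c).
Proof.
rewrite -(@pi_zeror _ _ _ _ _ (cohomology R N i)).
split=> [/eqP|cob]; first by rewrite -Quotient.idealrBE subr0 => /asboolP.
by apply/eqP; rewrite -Quotient.idealrBE subr0; apply/asboolP.
Qed.

Lemma cohomology_eq0 (M : A) (R : augmented M) (N : A) i :
  (forall x : cohomology R N i, x = 0) <->
  (forall f : hom (aug_ob R i) N, f ∘ aug_d R i = 0 -> is_coboundary f).
Proof.
split=> [coh0 f /eqP fd0 | cob x].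
  exact/(cohomology_class_eq0 (Cocycle (fd0 : f \in cocycles R N i))).
rewrite -[x]reprK; apply/cohomology_class_eq0/cob.
by case: (repr x) => f fc; apply/eqP: fc.
Qed.

End Resolutions.

Lemma relative_exact_of_balanced (A : abelianCat) (X Y : A -> Prop) :
  balanced_pair X Y -> admissible X -> relative_exact X Y.
Proof.
move=> bp adm.
(* A right X-approximation, which is epi, factors through g. *)
have epiX (M N : A) (g : hom M N) : lifting X g -> epi g.
  move=> gX; have [P [f fap]] := balanced_contra bp N.
  have [XP _] := fap; have [u gu] := gX P f XP.
  move=> T a b agbg; apply: (adm _ _ _ fap).
  by rewrite -gu !compA agbg.
(* A coaugmentation M -> Y^0 factors through f, and is mono as it is injective
   on morphisms from X, by which every object is covered. *)
have monoY (M N : A) (f : hom M N) : extending Y f -> mono f.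
  move=> fY; have [R [[YR acR] acX]] := balanced_cores bp M.
  have [u uf] := fY _ (coaug_e R) (YR 0%N).
  apply: monoI => K g fg0; have [P [p [XP pP]]] := balanced_contra bp K.
  apply: (epi_eq0 (adm _ _ _ (conj XP pP))).
  have [ex _] := acX P XP (Negz 1) (g ∘ p).
  have [|v /= <-] := ex; last exact: comp0m.
  by rewrite /= -uf -!compA (compA f) fg0 comp0m compm0.
split=> // M.
- have [R [[XR acR] acY]] := balanced_res bp M.
  have [||| K [k ke]] :=
    acyclic_conflation epiX (aug_dd R 0) (aug_ed R) (Y := Y).
  + exact: resolution_lifting.
  + move=> T h XT; exact: (acR T XT (Negz 1) h).1.
  + move=> T h YT; exact: (acY T YT (Negz 2) h).1.
  by exists K, (aug_ob R 0), k, (aug_e R).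
- have [R [[YR acR] acX]] := balanced_cores bp M.
  have [|||K [k /conflation_op ke]] :=
    @acyclic_conflation (op_cat A) Y X _ _ _ _ (coaug_d R 1)
      (coaug_d R 0) (coaug_e R) (fun M N => @monoY N M)
    (coaug_dd R 0) (coaug_de R).
  + move=> T h YT; have [ex _] := acR T YT (Negz 1) h.
    by apply: ex; apply: compm0.
  + move=> T h YT; exact: (acR T YT (Negz 0) h).1.
  + move=> T h XT; exact: (acX T XT (Posz 0) h).1.
  by exists (coaug_ob R 0), K, (coaug_e R), k.
Qed.

Section RelativeExtVanishing.
Variables (A : abelianCat) (X Y : A -> Prop).
Hypotheses (bp : balanced_pair X Y) (adm : admissible X).
Let rel := relative_exact_of_balanced bp adm.

Lemma chosen_resolutionP (M : A) : is_resolution X (chosen_resolution bp M).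
Proof. by rewrite /chosen_resolution; case: cid. Qed.

Lemma Ext1_vanishes_orthogonal (M N : A) :
  Ext_vanishes bp 1 M N <-> orthogonal X Y M N.
Proof.
have [XR acR] := chosen_resolutionP M.
have [Z [k [p [kb kp pX]]]] := resolution_syzygy acR 0.
have cf := deflation_conflation rel (resolution_lifting acR) kb.
rewrite -(presentation_orthogonal rel N (XR 0%N) cf).
rewrite -(syzygy_extending acR N (lifting_epi rel) kb kp pX).
exact: cohomology_eq0.
Qed.

(** Dimension shifting: Ext^2(M, N) = 0 implies Ext^1(K, N) = 0, where K is a
    syzygy of [M]. *)
Lemma presentation_Ext2 (M : A) :
  exists K P (k : hom K P) (p : hom P M), [/\ X P, conflation X Y k p &
    forall N, Ext_vanishes bp 2 M N -> orthogonal X Y K N].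
Proof.
have [XR acR] := chosen_resolutionP M.
have [Z [k [p [kb kp pX]]]] := resolution_syzygy acR 0.
have [Z' [k' [p' [kb' kp' pX']]]] := resolution_syzygy acR 1.
have cf := deflation_conflation rel (resolution_lifting acR) kb.
exists Z, (aug_ob (chosen_resolution bp M) 0), k, (aug_e _); split=> // N ext2.
have kp1 : is_kernel k' p.
  apply: kernelI (kernel_mono kb') _ _.
    apply: (mono_eq0 (kernel_mono kb)).
    by rewrite compA kp; case: kb'.
  by move=> T g pg0; apply: (kernel_lift kb'); rewrite /= -kp -compA pg0 compm0.
have cf' := deflation_conflation rel pX kp1.
apply/(presentation_orthogonal rel N (XR 1%N) cf').
by apply/(syzygy_extending acR N (lifting_epi rel) kb' kp' pX')/cohomology_eq0.
Qed.

End RelativeExtVanishing.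

(** If every object of [C] has a syzygy in [C], then [D] is closed under cokernels of
    inflations: a morphism from a syzygy K, itself in [C], to N lifts to M,
    and then extends. *)
Lemma cokernel_closed (A : abelianCat) (X Y C D : A -> Prop) :
  relative_exact X Y ->
  (forall N, D N <-> (forall M, C M -> orthogonal X Y M N)) ->
  (forall M, C M -> exists K P (k : hom K P) (p : hom P M),
     [/\ X P, conflation X Y k p & C K]) ->
  forall L M N (f : hom L M) (g : hom M N),
    conflation X Y f g -> D L -> D M -> D N.
Proof.
move=> rel DP syz L M N f g fg DL DM; apply/DP => M' CM'.
have [K [P [k [p [XP kp CK]]]]] := syz M' CM'.
apply/(presentation_orthogonal rel N XP kp) => h.
have [a <-] := (orthogonalE rel K L).1 ((DP L).1 DL K CK) _ _ _ _ fg h.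
have [b <-] := (DP M).1 DM M' CM' _ _ _ _ kp a.
by exists (g ∘ b); rewrite compA.
Qed.

Lemma hereditary_cotorsion_of_Ext (A : abelianCat) (X Y : A -> Prop)
    (bp : balanced_pair X Y) (C D : A -> Prop) :
  admissible X -> cotorsion_pair bp C D -> hereditary bp C D ->
  hereditary_cotorsion X Y C D.
Proof.
move=> adm cot her; have rel := relative_exact_of_balanced bp adm.
have CP M : C M <-> (forall N, D N -> orthogonal X Y M N).
  split=> [CM N DN | o].
    exact/(Ext1_vanishes_orthogonal bp adm)/((cotorsion_leftP cot M).1 CM).
  by apply/(cotorsion_leftP cot) => N /o/(Ext1_vanishes_orthogonal bp adm).
have DP N : D N <-> (forall M, C M -> orthogonal X Y M N).
  split=> [DN M CM | o].
    exact/(Ext1_vanishes_orthogonal bp adm)/((cotorsion_rightP cot N).1 DN).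
  by apply/(cotorsion_rightP cot) => M /o/(Ext1_vanishes_orthogonal bp adm).
have coker : forall L M N (f : hom L M) (g : hom M N),
    conflation X Y f g -> D L -> D M -> D N.
  apply: (cokernel_closed rel DP) => M CM.
  have [K [P [k [p [XP kp ext2]]]]] := presentation_Ext2 bp adm M.
  exists K, P, k, p; split=> //; apply/CP => N DN.
  by apply/ext2/her.
split=> // L M N f g /conflation_op fg CM CN.
apply: (@cokernel_closed (op_cat A) Y X D C (relative_exact_op rel) _ _
  N M L g f fg CN CM).
  move=> K; split=> [CK T DT | o].
    by apply/orthogonal_op/(orthogonalE rel)/((CP K).1 CK).
  by apply/CP => T /o/orthogonal_op/(orthogonalE rel).
(* The injective I is in D, and hence so is the cosyzygy Z. *)
move=> T DT; have [I [Z [i [q [YI iq]]]]] := enough_inj rel T.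
have DI : D I by apply/DP => K _; apply: orthogonal_Y.
exists Z, I, q, i; split=> //; first exact/conflation_op.
exact: coker iq DT DI.
Qed.

Theorem theorem3p15 (A : abelianCat) (X Y : A -> Prop)
    (bp : balanced_pair X Y) (adm : admissible X)
    (C D : A -> Prop) (cot : cotorsion_pair bp C D) (her : hereditary bp C D) :
  (perfect C D <->
     (forall M : A, has_minimal_right_approximation C M) /\
     (forall M : A, C M -> has_minimal_left_approximation D M)) /\
  (perfect C D <->
     (forall M : A, has_minimal_left_approximation D M) /\
     (forall M : A, D M -> has_minimal_right_approximation C M)).
Proof.
have hc := hereditary_cotorsion_of_Ext adm cot her.
split; split=> [perf | [min1 min2] M].
- by split=> M *; case: (perf M).
- by split; last exact: (minimal_left_of_minimal_right hc).
- by split=> M *; case: (perf M).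
- by split; first exact: (minimal_right_of_minimal_left hc).
Qed.
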